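(* $\mathrm{HS}_{\mathsf{lin}}$ and $\mathrm{HS}_{\mathsf{st}}$ are expressively incomparable, and so are $\mathrm{HS}_{\mathsf{lin}}$ and $\mathrm{HS}_{\mathsf{ct}}$.
   Context: A Kripke structure over a finite set $\mathcal{AP}$ is $K=(\mathcal{AP},S,\delta,\mu,s_0)$ with states $S$, left-total $\delta\subseteq S\times S$, labelling $\mu:S\to2^{\mathcal{AP}}$, initial state $s_0$; finite if $S$ is finite. An infinite path is an infinite state sequence following $\delta$; a trace is a non-empty finite prefix of one; initial means starting at $s_0$. For a finite word $w=w(0)\cdots w(n)$, $\mathrm{Pref}(w)=\{w[0,i]\mid 0\le i\le n-1\}$, $\mathrm{Suff}(w)=\{w[i,n]\mid 1\le i\le n\}$. The computation tree $C(K)$ has as states the initial traces of $K$, initial state $s_0$, labelling $\rho\mapsto\mu(\text{last state of }\rho)$, transitions $(\rho,\rho\cdot s)$. $\mathrm{HS}$ formulas: $\psi::=p\mid\neg\psi\mid\psi\wedge\psi\mid\langle X\rangle\psi$ for the Allen relations $A,L,B,E,D,O$ and inverses; all modalities are definable (non-strict semantics) from $\langle B\rangle,\langle E\rangle,\langle\bar B\rangle,\langle\bar E\rangle$. State-based: over traces of $K$, $\rho\models p$ iff $p\in\mu(s)$ for every state $s$ of $\rho$; $\rho\models\langle B\rangle\psi$ iff some $\rho'\in\mathrm{Pref}(\rho)$ satisfies $\psi$; $\rho\models\langle E\rangle\psi$ iff some $\rho'\in\mathrm{Suff}(\rho)$ does; $\rho\models\langle\bar B\rangle\psi$ iff some trace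 $\rho'$ with $\rho\in\mathrm{Pref}(\rho')$ does; $\rho\models\langle\bar E\rangle\psi$ iff some trace $\rho'$ with $\rho\in\mathrm{Suff}(\rho')$ does. $K\models_{\mathsf{st}}\psi$ iff every initial trace satisfies $\psi$. Computation-tree-based: $K\models_{\mathsf{ct}}\psi$ iff $C(K)\models_{\mathsf{st}}\psi$. Trace-based: for an infinite path $\pi$, intervals $[i,j]$, $0\le i\le j$; $[i,j]\models p$ iff $p\in\mu(\pi(h))$ for all $i\le h\le j$; $[x,y]\models\langle B\rangle\psi$ iff $[x,z]\models\psi$ for some $x\le z<y$; $\langle E\rangle$: $[v,y]$ for some $x<v\le y$; $\langle\bar B\rangle$: $[x,z]$ for some $z>y$; $\langle\bar E\rangle$: $[v,y]$ for some $v<x$. $K\models_{\mathsf{lin}}\psi$ iff for every initial infinite path $\pi$ and $i\ge0$, $[0,i]\models\psi$ in $\pi$. $\mathrm{HS}_{\mathsf{st}},\mathrm{HS}_{\mathsf{ct}},\mathrm{HS}_{\mathsf{lin}}$ denote $\mathrm{HS}$ under these semantics. Expressiveness: $\varphi_1\in L_1$, $\varphi_2\in L_2$ are equivalent if for every finite Kripke structure $K$, $K$ is a model of $\varphi_1$ in $L_1$ iff of $\varphi_2$ in $L_2$; $L_1\ge L_2$ if every $L_2$ formula has an equivalent $L_1$ formula; $L_1,L_2$ are expressively incomparable if $L_1\not\ge L_2$ and $L_2\not\ge L_1$. *)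

(* Defs.v *)
From mathcomp Require Import all_boot.

Set Implicit Arguments.
Unset Strict Implicit.
Unset Printing Implicit Defensive.

Inductive hs (AP : Type) : Type :=
| HProp : AP -> hs AP
| HNeg : hs AP -> hs AP
| HAnd : hs AP -> hs AP -> hs AP
| HB : hs AP -> hs AP
| HE : hs AP -> hs AP
| HBbar : hs AP -> hs AP
| HEbar : hs AP -> hs AP.

Record kripke (AP : finType) := Kripke {
  kst : Type;
  kdelta : kst -> kst -> Prop;
  kmu : kst -> {set AP};
  ks0 : kst;
  ktotal : forall s, exists t, kdelta s t }.

Record fin_kripke (AP : finType) := FinKripke {
  fk_st : finType;
  fk_delta : rel fk_st;
  fk_mu : fk_st -> {set AP};
  fk_s0 : fk_st;
  fk_total : forall s, exists t, fk_delta s t }.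

Definition kripke_of_fin (AP : finType) (K : fin_kripke AP) : kripke AP :=
  @Kripke AP (fk_st K) (fun x y => @fk_delta AP K x y) (@fk_mu AP K) (@fk_s0 AP K)
    (@fk_total AP K).
Coercion kripke_of_fin : fin_kripke >-> kripke.

Fixpoint follows (S : Type) (d : S -> S -> Prop) (x : S) (l : seq S) : Prop :=
  match l with
  | [::] => True
  | y :: l' => d x y /\ follows d y l'
  end.

Definition is_trace (AP : finType) (K : kripke AP) (rho : seq (kst K)) : Prop :=
  match rho with
  | [::] => False
  | x :: l => follows (@kdelta AP K) x l
  end.

Definition is_init_trace (AP : finType) (K : kripke AP) (rho : seq (kst K)) : Prop :=
  match rho with
  | [::] => False
  | x :: l => x = ks0 K /\ follows (@kdelta AP K) x l
  end.

Fixpoint sat_st (AP : finType) (K : kripke AP) (f : hs AP) (rho : seq (kst K)) : Prop :=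
  match f with
  | HProp p => all (fun s => p \in kmu s) rho
  | HNeg g => ~ sat_st g rho
  | HAnd g h => sat_st g rho /\ sat_st h rho
  | HB g => exists k, 0 < k < size rho /\ sat_st g (take k rho)
  | HE g => exists k, 0 < k < size rho /\ sat_st g (drop k rho)
  | HBbar g => exists ext, ext <> [::] /\ is_trace (rho ++ ext) /\ sat_st g (rho ++ ext)
  | HEbar g => exists ext, ext <> [::] /\ is_trace (ext ++ rho) /\ sat_st g (ext ++ rho)
  end.

Definition models_st (AP : finType) (K : kripke AP) (f : hs AP) : Prop :=
  forall rho : seq (kst K), is_init_trace rho -> sat_st f rho.

Lemma follows_rcons (S : Type) (d : S -> S -> Prop) (l : seq S) (x t : S) :
  follows d x l -> d (last x l) t -> follows d x (rcons l t).
Proof. by elim: l x => [|y l IH] x //= [H1 H2] H3; split => //; apply: IH. Qed.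

Definition ct_state (AP : finType) (K : kripke AP) :=
  {rho : seq (kst K) | is_init_trace rho}.

Definition ct_delta (AP : finType) (K : kripke AP) (r r' : ct_state K) : Prop :=
  exists s, sval r' = rcons (sval r) s.

Definition ct_mu (AP : finType) (K : kripke AP) (r : ct_state K) : {set AP} :=
  kmu (last (ks0 K) (sval r)).

Lemma ct_s0_proof (AP : finType) (K : kripke AP) : @is_init_trace AP K [:: ks0 K].
Proof. by []. Qed.

Definition ct_s0 (AP : finType) (K : kripke AP) : ct_state K :=
  exist _ [:: ks0 K] (ct_s0_proof K).

Lemma ct_total (AP : finType) (K : kripke AP) (r : ct_state K) :
  exists r', ct_delta r r'.
Proof.
case: r => [[|x l] //= [Hx Hl]].
have [t Ht] := ktotal (last x l).
have H : @is_init_trace AP K (x :: rcons l t).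
  by split => //; apply: follows_rcons.
by exists (exist _ (x :: rcons l t) H); exists t.
Qed.

Definition comp_tree (AP : finType) (K : kripke AP) : kripke AP :=
  @Kripke AP (ct_state K) (@ct_delta AP K) (@ct_mu AP K) (ct_s0 K) (@ct_total AP K).

Definition inf_init_path (AP : finType) (K : kripke AP) (pi : nat -> kst K) : Prop :=
  pi 0 = ks0 K /\ forall i, kdelta (pi i) (pi i.+1).

Fixpoint sat_lin (AP : finType) (K : kripke AP) (pi : nat -> kst K) (f : hs AP)
    (x y : nat) : Prop :=
  match f with
  | HProp p => forall h, x <= h <= y -> p \in kmu (pi h)
  | HNeg g => ~ sat_lin pi g x y
  | HAnd g h => sat_lin pi g x y /\ sat_lin pi h x y
  | HB g => exists z, x <= z < y /\ sat_lin pi g x z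
  | HE g => exists v, x < v <= y /\ sat_lin pi g v y
  | HBbar g => exists z, y < z /\ sat_lin pi g x z
  | HEbar g => exists v, v < x /\ sat_lin pi g v y
  end.

Definition models_lin (AP : finType) (K : kripke AP) (f : hs AP) : Prop :=
  forall pi : nat -> kst K, inf_init_path pi -> forall i, sat_lin pi f 0 i.

Definition semantics (AP : finType) := fin_kripke AP -> hs AP -> Prop.

Definition HS_st (AP : finType) : semantics AP := fun K f => models_st K f.
Definition HS_ct (AP : finType) : semantics AP := fun K f => models_st (comp_tree K) f.
Definition HS_lin (AP : finType) : semantics AP := fun K f => models_lin K f.

Definition expr_geq (AP : finType) (L1 L2 : semantics AP) : Prop :=
  forall f2 : hs AP, exists f1 : hs AP,
    forall K : fin_kripke AP, L1 K f1 <-> L2 K f2.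

Definition expr_incomparable (AP : finType) (L1 L2 : semantics AP) : Prop :=
  ~ expr_geq L1 L2 /\ ~ expr_geq L2 L1.

(* Main.v *)
(**
  Linear semantics only sees the labels along infinite paths, so it is preserved
  when a structure loses branches; "some [p]-state is always reachable" is not.
  Conversely, let a chain of states, numbered by their distance to an absorbing
  [p]-state, end in a state [M] with a self-loop.  Starting just below [M], all
  paths meet [p] infinitely often; starting in [M], one path never does.  For [M]
  exponential in the modal depth, an Ehrenfeucht-Fraisse game on the gaps between
  the ends of an interval and the first [p]-position shows that neither the
  state-based nor the computation-tree-based semantics separates the two initial
  states: a move from a position with gaps equal up to a threshold [2T] can be
  answered so that the gaps are again equal up to [T].
*)
Require Import Defs.
From Stdlib Require Import Classical Arith Lia.
From mathcomp Require Import all_boot zify.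

Set Implicit Arguments.
Unset Strict Implicit.
Unset Printing Implicit Defensive.

(** * Frames with four kinds of moves and the Ehrenfeucht-Fraisse game on them *)

Variant move := MB | ME | MBbar | MEbar.

(** Positions are left abstract so that one satisfaction relation covers both traces and the tuples
    of numbers that encode them. *)
Fixpoint sat_frame (AP C : Type) (lab : AP -> C -> Prop)
    (step : move -> C -> C -> Prop) (f : hs AP) (c : C) : Prop :=
  match f with
  | HProp p => lab p c
  | HNeg g => ~ sat_frame lab step g c
  | HAnd g h => sat_frame lab step g c /\ sat_frame lab step h c
  | HB g => exists c', step MB c c' /\ sat_frame lab step g c'
  | HE g => exists c', step ME c c' /\ sat_frame lab step g c'
  | HBbar g => exists c', step MBbar c c' /\ sat_frame lab step g c'
  | HEbar g => exists c', step MEbar c c' /\ sat_frame lab step g c'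
  end.

Fixpoint hs_depth (AP : Type) (f : hs AP) : nat :=
  match f with
  | HProp _ => 0
  | HNeg g => hs_depth g
  | HAnd g h => maxn (hs_depth g) (hs_depth h)
  | HB g | HE g | HBbar g | HEbar g => (hs_depth g).+1
  end.

(** [R n] collects the positions from which the duplicator survives [n] more rounds. Boolean
    connectives keep the position, each modality spends one round, and so the modal depth bounds the
    rounds needed. *)
Lemma sat_frame_game (AP C1 C2 : Type)
    (lab1 : AP -> C1 -> Prop) (step1 : move -> C1 -> C1 -> Prop)
    (lab2 : AP -> C2 -> Prop) (step2 : move -> C2 -> C2 -> Prop)
    (R : nat -> C1 -> C2 -> Prop) :
  (forall n c1 c2 p, R n c1 c2 -> lab1 p c1 <-> lab2 p c2) ->
  (forall n d c1 c1' c2, R n.+1 c1 c2 -> step1 d c1 c1' ->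
     exists c2', step2 d c2 c2' /\ R n c1' c2') ->
  (forall n d c1 c2 c2', R n.+1 c1 c2 -> step2 d c2 c2' ->
     exists c1', step1 d c1 c1' /\ R n c1' c2') ->
  forall f n c1 c2, hs_depth f <= n -> R n c1 c2 ->
    sat_frame lab1 step1 f c1 <-> sat_frame lab2 step2 f c2.
Proof.
move=> labR forth back.
have modal g d n c1 c2 :
    (forall n c1 c2, hs_depth g <= n -> R n c1 c2 ->
      sat_frame lab1 step1 g c1 <-> sat_frame lab2 step2 g c2) ->
    hs_depth g < n -> R n c1 c2 ->
    (exists c', step1 d c1 c' /\ sat_frame lab1 step1 g c') <->
    (exists c', step2 d c2 c' /\ sat_frame lab2 step2 g c').
  case: n => // n IH len Rc; split=> -[c' [sc gc]].
    have [c2' [s2 R']] := forth _ _ _ _ _ Rc sc.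
    by exists c2'; split=> //; apply/(IH _ _ _ len R').
  have [c1' [s1 R']] := back _ _ _ _ _ Rc sc.
  by exists c1'; split=> //; apply/(IH _ _ _ len R').
elim=> [p|g IH|g IHg h IHh|g IH|g IH|g IH|g IH] n c1 c2 /= len Rc;
  try by apply: modal Rc.
- exact: labR Rc.
- by split=> ng /(IH _ _ _ len Rc).
- move: len; rewrite geq_max => /andP[leg leh].
  by split=> -[/(IHg _ _ _ leg Rc) ? /(IHh _ _ _ leh Rc) ?].
Qed.

(** * Trace semantics as a frame *)

Section Traces.
Variables (AP : finType) (K : kripke AP).

Definition trace_lab (p : AP) (rho : seq (kst K)) : Prop :=
  all (fun s => p \in kmu s) rho.

Definition trace_step (d : move) (rho rho' : seq (kst K)) : Prop :=
  match d with
  | MB => exists k, 0 < k < size rho /\ rho' = take k rho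
  | ME => exists k, 0 < k < size rho /\ rho' = drop k rho
  | MBbar => exists ext, ext <> [::] /\ is_trace rho' /\ rho' = rho ++ ext
  | MEbar => exists ext, ext <> [::] /\ is_trace rho' /\ rho' = ext ++ rho
  end.

Lemma sat_stE (f : hs AP) (rho : seq (kst K)) :
  sat_st f rho <-> sat_frame trace_lab trace_step f rho.
Proof.
elim: f rho => [p|g IH|g IHg h IHh|g IH|g IH|g IH|g IH] rho //=.
- by split=> ng /IH.
- by split=> -[/IHg ? /IHh ?].
- split=> [[k [kr /IH gk]]|[_ [[k [kr ->]] /IH gk]]]; last by exists k.
  by exists (take k rho); split=> //; exists k.
- split=> [[k [kr /IH gk]]|[_ [[k [kr ->]] /IH gk]]]; last by exists k.
  by exists (drop k rho); split=> //; exists k.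
- split=> [[e [e0 [tr /IH ge]]]|[r [[e [e0 [tr re]]] /IH ge]]].
    by exists (rho ++ e); split=> //; exists e.
  by exists e; rewrite -re.
- split=> [[e [e0 [tr /IH ge]]]|[r [[e [e0 [tr re]]] /IH ge]]].
    by exists (e ++ rho); split=> //; exists e.
  by exists e; rewrite -re.
Qed.

Definition always (f : hs AP) : hs AP := HAnd f (HNeg (HBbar (HNeg f))).

(** Every initial trace is [[:: ks0 K]] or a proper right extension of it. Being a model thus
    becomes satisfaction at a single position, from which a game can start. *)
Lemma models_stE (f : hs AP) :
  models_st K f <-> sat_st (always f) [:: ks0 K].
Proof.
split=> [mf|[f0 fext] [|x l] //= [-> fl]].
  split; first exact: mf.
  by case=> ext [_ [tr]]; apply; apply: mf.
case: l fl => [|y l] fl //; apply: NNPP => nf; apply: fext.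
by exists (y :: l).
Qed.

End Traces.


(** * Games on numerical codes of traces *)

Section ChainGames.

(* Peano arithmetic, which [lia] decides much faster than the boolean one. *)
Local Notation "m + n" := (Nat.add m n) : nat_scope.
Local Notation "m - n" := (Nat.sub m n) : nat_scope.
Local Notation "m <= n" := (le m n) : nat_scope.
Local Notation "m < n" := (lt m n) : nat_scope.

Definition eq_upto (T x y : nat) : Prop := x = y \/ T <= x /\ T <= y.

Ltac eq_upto_lia := unfold eq_upto in *; lia.

Lemma eq_upto_sym (T x y : nat) : eq_upto T x y -> eq_upto T y x.
Proof. by rewrite /eq_upto; lia. Qed.

(** When [x] is cut in two, a part shorter than [T] is copied exactly and the rest of [y] stays
    large enough. If both parts reach [T], the cut of [y] at [T] works, unless [x = y] and the cut
    can be copied. *)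
Lemma eq_upto_split (T x y k : nat) :
  eq_upto (T + T) x y -> k <= x ->
  exists s t, [/\ y = s + t, eq_upto T k s & eq_upto T (x - k) t].
Proof.
rewrite /eq_upto => xy kx; case: (le_lt_dec T k) => kT; last first.
  by exists k, (y - k); split; lia.
case: (le_lt_dec T (x - k)) => xkT; last first.
  by exists (y - (x - k)), (x - k); split; lia.
case: xy => [<-|xy]; first by exists k, (x - k); split; lia.
by exists T, (y - T); split; lia.
Qed.

Variable M : nat.

(* [q] and [q'] give the same [chain_path] of length [L]: either they are equal,
   or the whole trace stays in the loop at [M]. *)
Definition same_upto (L q q' : nat) : Prop :=
  q = q' \/ M + L <= q + 1 /\ M + L <= q' + 1.

(* [(q, L)] stands for the trace [chain_path q L]. *)
Definition st_step (d : move) (c c' : nat * nat) : Prop :=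
  let: (q, L) := c in let: (q', L') := c' in
  match d with
  | MB => q' = q /\ 0 < L' /\ L' < L
  | ME => exists k, (0 < k /\ k < L) /\ q' = q - k /\ L' = L - k
  | MBbar => L < L' /\ same_upto L q q'
  | MEbar => exists k, 0 < k /\ L' = L + k /\ q' - k = q
  end.

(* The two constructors tell whether the trace ends before or after the first
   [p]-position [q]. *)
Inductive st_sim (T : nat) : nat * nat -> nat * nat -> Prop :=
| StWhite q L q' L' e e' of q = L + e & q' = L' + e' & 0 < L & 0 < L' &
    eq_upto T L L' & eq_upto T e e' : st_sim T (q, L) (q', L')
| StBlack q L q' L' b b' of L = q + b & L' = q' + b' & 0 < b & 0 < b' &
    eq_upto T q q' & eq_upto T b b' : st_sim T (q, L) (q', L').

Lemma st_sim_sym T c c' : st_sim T c c' -> st_sim T c' c.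
Proof.
by case=> q L q' L' w w' *; [apply: (@StWhite _ _ _ _ _ w' w)
  |apply: (@StBlack _ _ _ _ _ w' w)] => //; apply: eq_upto_sym.
Qed.

(** Prefixes and suffixes cut one gap, which [eq_upto_split] answers; left extensions only lengthen
    the part before the end or before [q]. The delicate move is the right extension, which may
    change [q] as long as the trace is still waiting in [M]. *)
Lemma st_sim_step T d c1 c1' c2 :
  0 < T -> T + T < M -> st_sim (T + T) c1 c2 -> st_step d c1 c1' ->
  exists c2', st_step d c2 c2' /\ st_sim T c1' c2'.
Proof.
move=> T0 TM; case: c1' => q1 L1 [] q L q' L'.
- move=> e e' -> -> L0 L'0 hL he.
  case: d => /=.
  + case=> -> [L10 L1L].
    have [|k [l [-> hk hl]]] := eq_upto_split (k := L1) hL; first by lia.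
    exists (k + l + e', k); split; first by eq_upto_lia.
    by apply: (@StWhite _ _ _ _ _ (L - L1 + e) (l + e')); eq_upto_lia.
  + case=> j [[j0 jL] [-> ->]].
    have [|k [l [-> hk hl]]] := eq_upto_split (k := j) hL; first by lia.
    exists (l + e', l); split; first by exists k; eq_upto_lia.
    by apply: (@StWhite _ _ _ _ _ e e'); eq_upto_lia.
  + rewrite /same_upto; case=> LL1 sq.
    (* The last state of the trace has number [e + 1] if that is below [M]. With [e < T + T < M] the
       loop has therefore been left or is excluded, so [q1 = q]; since also [e = e'], the extension
       is copied. *)
    case: (le_lt_dec (T + T) e) => eT; last first.
      have ee : e = e' by eq_upto_lia.
      have {}sq : q1 = L + e by lia.
      exists (L' + e', L' + (L1 - L)); split; first by lia.
      case: (le_lt_dec L1 q1) => L1q1.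
        by apply: (@StWhite _ _ _ _ _ (q1 - L1) (q1 - L1)); eq_upto_lia.
      by apply: (@StBlack _ _ _ _ _ (L1 - q1) (L1 - q1)); eq_upto_lia.
    (* Now [q1] may exceed [q], but the answer can keep [L' + e']: the gap [e'] has room for two
       pieces of length [T], one for the added states and one for what remains before the first
       [p]. *)
    have {}he : T + T <= e' by eq_upto_lia.
    case: (le_lt_dec L1 q1) => L1q1; last first.
      exists (L' + e', L' + e' + (L1 - q1)); split; first by lia.
      by apply: (@StBlack _ _ _ _ _ (L1 - q1) (L1 - q1)); eq_upto_lia.
    case: (le_lt_dec T (q1 - L1)) => e1T; last first.
      exists (L' + e', L' + e' - (q1 - L1)); split; first by lia.
      by apply: (@StWhite _ _ _ _ _ (q1 - L1) (q1 - L1)); eq_upto_lia.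
    case: (le_lt_dec T (L1 - L)) => kT.
      exists (L' + e', L' + T); split; first by lia.
      by apply: (@StWhite _ _ _ _ _ (q1 - L1) (e' - T)); eq_upto_lia.
    exists (L' + e', L' + (L1 - L)); split; first by lia.
    by apply: (@StWhite _ _ _ _ _ (q1 - L1) (e' - (L1 - L))); eq_upto_lia.
  + case=> k [k0 [-> q1k]].
    exists (L' + e' + k, L' + k); split; first by exists k; lia.
    by apply: (@StWhite _ _ _ _ _ e e'); eq_upto_lia.
- move=> b b' -> -> b0 b'0 hq hb.
  case: d => /=.
  + case=> -> [L10 L1L]; case: (le_lt_dec L1 q) => L1q.
      have [|k [l [-> hk hl]]] := eq_upto_split (k := L1) hq; first by lia.
      exists (k + l, k); split; first by eq_upto_lia.
      by apply: (@StWhite _ _ _ _ _ (q - L1) l); eq_upto_lia.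
    have [|k [l [-> hk hl]]] := eq_upto_split (k := L1 - q) hb; first by lia.
    exists (q', q' + k); split; first by eq_upto_lia.
    by apply: (@StBlack _ _ _ _ _ (L1 - q) k); eq_upto_lia.
  + case=> j [[j0 jL] [-> ->]]; case: (le_lt_dec j q) => jq.
      have [|k [l [-> hk hl]]] := eq_upto_split (k := j) hq; first by lia.
      exists (l, l + b'); split; first by exists k; eq_upto_lia.
      by apply: (@StBlack _ _ _ _ _ b b'); eq_upto_lia.
    have [|k [l [-> hk hl]]] := eq_upto_split (k := j - q) hb; first by lia.
    (* Once the cut passes [q], the suffix starts in the absorbing state, so its first coordinate is
       truncated to [0]. *)
    exists (0, l); split; first by exists (q' + k); eq_upto_lia.
    by apply: (@StBlack _ _ _ _ _ (q + b - j) l); eq_upto_lia.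
  + case=> LL1 sq; rewrite /same_upto in sq *.
    have {}sq : q1 = q by lia.
    exists (q', q' + b' + (L1 - q - b)); split; first by lia.
    by apply: (@StBlack _ _ _ _ _ (L1 - q) (b' + (L1 - q - b))); eq_upto_lia.
  + case=> k [k0 [-> q1k]].
    (* As [q1 - k = q] is truncated, [q = 0] allows any [q1 <= k]: the prepended states may already
       reach [p]. Here [q' = 0] too, so the same [q1] is the answer. If [q] is positive,
       [q1 = q + k] is forced. *)
    case: (Nat.eq_dec q 0) => q0.
      exists (q1, q' + b' + k); split; first by exists k; eq_upto_lia.
      by apply: (@StBlack _ _ _ _ _ (b + k - q1) (b' + k - q1)); eq_upto_lia.
    exists (q' + k, q' + b' + k); split; first by exists k; lia.
    by apply: (@StBlack _ _ _ _ _ b b'); eq_upto_lia.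
Qed.

(* [(x, q, L)] stands for the interval from [x] to [L - 1] of the initial trace
   [chain_path q L], i.e. for a trace of the computation tree. *)
Definition ct_step (d : move) (c c' : nat * nat * nat) : Prop :=
  let: (x, q, L) := c in let: (x', q', L') := c' in
  match d with
  | MB => x' = x /\ q' = q /\ x < L' /\ L' < L
  | ME => L' = L /\ q' = q /\ x < x' /\ x' < L
  | MBbar => x' = x /\ L < L' /\ same_upto L q q'
  | MEbar => L' = L /\ q' = q /\ x' < x
  end.

(* The first [p]-position [q] lies after, inside or before the interval. *)
Inductive ct_sim (T : nat) :
    nat * nat * nat -> nat * nat * nat -> Prop :=
| CtWhite x q L x' q' L' a e a' e' of L = x + a & L' = x' + a' &
    q = L + e & q' = L' + e' & 0 < a & 0 < a' &
    eq_upto T x x' & eq_upto T a a' & eq_upto T e e' :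
    ct_sim T (x, q, L) (x', q', L')
| CtMixed x q L x' q' L' a b a' b' of q = x + a & q' = x' + a' &
    L = q + b & L' = q' + b' & 0 < b & 0 < b' &
    eq_upto T x x' & eq_upto T a a' & eq_upto T b b' :
    ct_sim T (x, q, L) (x', q', L')
| CtBlack x q L x' q' L' v b v' b' of x = q + v & x' = q' + v' &
    L = x + b & L' = x' + b' & 0 < b & 0 < b' &
    eq_upto T q q' & eq_upto T v v' & eq_upto T b b' :
    ct_sim T (x, q, L) (x', q', L').

Lemma ct_sim_sym T c c' : ct_sim T c c' -> ct_sim T c' c.
Proof.
by case=> x q L x' q' L' w z w' z' *;
  [apply: (@CtWhite _ _ _ _ _ _ _ w' z' w z)
  |apply: (@CtMixed _ _ _ _ _ _ _ w' z' w z)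
  |apply: (@CtBlack _ _ _ _ _ _ _ w' z' w z)] => //; apply: eq_upto_sym.
Qed.

(** The past of the interval is now fixed, which adds a third gap. A left extension cuts the first
    gap and merges the remainder into the next one, while a right extension is answered as in the
    game on traces. *)
Lemma ct_sim_step T d c1 c1' c2 :
  0 < T -> T + T < M -> ct_sim (T + T) c1 c2 -> ct_step d c1 c1' ->
  exists c2', ct_step d c2 c2' /\ ct_sim T c1' c2'.
Proof.
move=> T0 TM; case: c1' => [[x1 q1] L1] [] x q L x' q' L'.
- move=> a e a' e' -> -> -> -> a0 a'0 hx ha he.
  case: d => /=.
  + case=> -> [-> [xL1 L1L]].
    have [|k [l [-> hk hl]]] := eq_upto_split (k := L1 - x) ha; first by lia.
    exists (x', x' + (k + l) + e', x' + k); split; first by eq_upto_lia.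
    by apply: (@CtWhite _ _ _ _ _ _ _ (L1 - x) (x + a - L1 + e) k (l + e'));
      eq_upto_lia.
  + case=> -> [-> [xx1 x1L]].
    have [|k [l [-> hk hl]]] := eq_upto_split (k := x1 - x) ha; first by lia.
    exists (x' + k, x' + (k + l) + e', x' + (k + l)); split.
      by eq_upto_lia.
    by apply: (@CtWhite _ _ _ _ _ _ _ (x + a - x1) e l e'); eq_upto_lia.
  + rewrite /same_upto; case=> -> [LL1 sq].
    case: (le_lt_dec (T + T) e) => eT; last first.
      have ee : e = e' by eq_upto_lia.
      have {}sq : q1 = x + a + e by lia.
      exists (x', x' + a' + e', x' + a' + (L1 - (x + a))); split; first by lia.
      case: (le_lt_dec L1 q1) => L1q1.
        by apply: (@CtWhite _ _ _ _ _ _ _ (L1 - x) (q1 - L1)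
          (a' + (L1 - (x + a))) (q1 - L1)); eq_upto_lia.
      by apply: (@CtMixed _ _ _ _ _ _ _ (a + e) (L1 - q1) (a' + e')
        (L1 - q1)); eq_upto_lia.
    have {}he : T + T <= e' by eq_upto_lia.
    case: (le_lt_dec L1 q1) => L1q1; last first.
      exists (x', x' + a' + e', x' + a' + e' + (L1 - q1)); split; first by lia.
      by apply: (@CtMixed _ _ _ _ _ _ _ (q1 - x) (L1 - q1) (a' + e')
        (L1 - q1)); eq_upto_lia.
    case: (le_lt_dec T (q1 - L1)) => e1T; last first.
      exists (x', x' + a' + e', x' + a' + e' - (q1 - L1)); split.
        by lia.
      by apply: (@CtWhite _ _ _ _ _ _ _ (L1 - x) (q1 - L1)
        (a' + e' - (q1 - L1)) (q1 - L1)); eq_upto_lia.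
    case: (le_lt_dec T (L1 - (x + a))) => kT.
      exists (x', x' + a' + e', x' + a' + T); split; first by lia.
      by apply: (@CtWhite _ _ _ _ _ _ _ (L1 - x) (q1 - L1) (a' + T)
        (e' - T)); eq_upto_lia.
    exists (x', x' + a' + e', x' + a' + (L1 - (x + a))); split; first by lia.
    by apply: (@CtWhite _ _ _ _ _ _ _ (L1 - x) (q1 - L1)
      (a' + (L1 - (x + a))) (e' - (L1 - (x + a)))); eq_upto_lia.
  + case=> -> [-> x1x].
    have [|k [l [-> hk hl]]] := eq_upto_split (k := x1) hx; first by lia.
    exists (k, k + l + a' + e', k + l + a'); split; first by eq_upto_lia.
    by apply: (@CtWhite _ _ _ _ _ _ _ (x - x1 + a) e (l + a') e');
      eq_upto_lia.
- move=> a b a' b' -> -> -> -> b0 b'0 hx ha hb.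
  case: d => /=.
  + case=> -> [-> [xL1 L1L]]; case: (le_lt_dec L1 (x + a)) => L1q.
      have [|k [l [-> hk hl]]] := eq_upto_split (k := L1 - x) ha; first by lia.
      exists (x', x' + (k + l), x' + k); split; first by eq_upto_lia.
      by apply: (@CtWhite _ _ _ _ _ _ _ (L1 - x) (x + a - L1) k l);
        eq_upto_lia.
    have [|k [l [-> hk hl]]] := eq_upto_split (k := L1 - (x + a)) hb.
      by lia.
    exists (x', x' + a', x' + a' + k); split; first by eq_upto_lia.
    by apply: (@CtMixed _ _ _ _ _ _ _ a (L1 - (x + a)) a' k); eq_upto_lia.
  + case=> -> [-> [xx1 x1L]]; case: (le_lt_dec x1 (x + a)) => x1q.
      have [|k [l [-> hk hl]]] := eq_upto_split (k := x1 - x) ha; first by lia.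
      exists (x' + k, x' + (k + l), x' + (k + l) + b'); split.
        by eq_upto_lia.
      by apply: (@CtMixed _ _ _ _ _ _ _ (x + a - x1) b l b'); eq_upto_lia.
    have [|k [l [-> hk hl]]] := eq_upto_split (k := x1 - (x + a)) hb.
      by lia.
    exists (x' + a' + k, x' + a', x' + a' + (k + l)); split.
      by eq_upto_lia.
    by apply: (@CtBlack _ _ _ _ _ _ _ (x1 - (x + a)) (x + a + b - x1) k l);
      eq_upto_lia.
  + rewrite /same_upto; case=> -> [LL1 sq].
    have {}sq : q1 = x + a by lia.
    exists (x', x' + a', x' + a' + b' + (L1 - (x + a + b))); split.
      by lia.
    by apply: (@CtMixed _ _ _ _ _ _ _ a (L1 - (x + a)) a'
      (b' + (L1 - (x + a + b)))); eq_upto_lia.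
  + case=> -> [-> x1x].
    have [|k [l [-> hk hl]]] := eq_upto_split (k := x1) hx; first by lia.
    exists (k, k + l + a', k + l + a' + b'); split; first by eq_upto_lia.
    by apply: (@CtMixed _ _ _ _ _ _ _ (x - x1 + a) b (l + a') b');
      eq_upto_lia.
- move=> v b v' b' -> -> -> -> b0 b'0 hq hv hb.
  case: d => /=.
  + case=> -> [-> [xL1 L1L]].
    have [|k [l [-> hk hl]]] := eq_upto_split (k := L1 - (q + v)) hb.
      by lia.
    exists (q' + v', q', q' + v' + k); split; first by eq_upto_lia.
    by apply: (@CtBlack _ _ _ _ _ _ _ v (L1 - (q + v)) v' k); eq_upto_lia.
  + case=> -> [-> [xx1 x1L]].
    have [|k [l [-> hk hl]]] := eq_upto_split (k := x1 - (q + v)) hb.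
      by lia.
    exists (q' + v' + k, q', q' + v' + (k + l)); split; first by eq_upto_lia.
    by apply: (@CtBlack _ _ _ _ _ _ _ (x1 - q) (q + v + b - x1) (v' + k) l);
      eq_upto_lia.
  + rewrite /same_upto; case=> -> [LL1 sq].
    have {}sq : q1 = q by lia.
    exists (q' + v', q', q' + v' + b' + (L1 - (q + v + b))); split.
      by lia.
    by apply: (@CtBlack _ _ _ _ _ _ _ v (L1 - (q + v)) v'
      (b' + (L1 - (q + v + b)))); eq_upto_lia.
  + case=> -> [-> x1x]; case: (le_lt_dec x1 q) => x1q.
      have [|k [l [-> hk hl]]] := eq_upto_split (k := x1) hq; first by lia.
      exists (k, k + l, k + l + v' + b'); split; first by eq_upto_lia.
      by apply: (@CtMixed _ _ _ _ _ _ _ (q - x1) (v + b) l (v' + b'));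
        eq_upto_lia.
    have [|k [l [-> hk hl]]] := eq_upto_split (k := x1 - q) hv; first by lia.
    exists (q' + k, q', q' + (k + l) + b'); split; first by eq_upto_lia.
    by apply: (@CtBlack _ _ _ _ _ _ _ (x1 - q) (q + v + b - x1) k (l + b'));
      eq_upto_lia.
Qed.

End ChainGames.

(** * Traces of the chain and their codes *)

Section Chain.
Variables (AP : finType) (M : nat).

(** Since [0.-1] is [0], the first disjunct also provides the absorbing loop at [0]. *)
Definition chain_next : rel 'I_M.+1 :=
  fun x y => (y == x.-1 :> nat) || (x == M :> nat) && (y == M :> nat).

Lemma chain_total x : exists y, chain_next x y.
Proof.
have lt_x : x.-1 < M.+1 by have := ltn_ord x; lia.
by exists (Ordinal lt_x); rewrite /chain_next eqxx.
Qed.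

Definition chain_mu (x : 'I_M.+1) : {set AP} :=
  if x == 0 :> nat then setT else set0.

Definition chain (i : nat) : fin_kripke AP :=
  FinKripke chain_mu (inord i) chain_total.

Definition chain_state (q : nat) : 'I_M.+1 := inord (minn M q).

(* The path that reaches state [0] at time [q], waiting in [M] if [q > M]. *)
Definition chain_path (q L : nat) : seq 'I_M.+1 :=
  mkseq (fun j => chain_state (q - j)) L.

Lemma val_chain_state q : chain_state q = minn M q :> nat.
Proof. by rewrite inordK // ltnS geq_minl. Qed.

Lemma chain_state_inj q q' :
  chain_state q = chain_state q' -> minn M q = minn M q'.
Proof. by move/(congr1 val); rewrite /= !val_chain_state. Qed.

Lemma chain_next_state q : chain_next (chain_state q) (chain_state q.-1).
Proof. by rewrite /chain_next !val_chain_state; lia. Qed.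

Lemma size_chain_path q L : size (chain_path q L) = L.
Proof. exact: size_mkseq. Qed.

Lemma nth_chain_path s q L j :
  j < L -> nth s (chain_path q L) j = chain_state (q - j).
Proof. exact: nth_mkseq. Qed.

Lemma chain_pathS q L :
  chain_path q L.+1 = chain_state q :: chain_path q.-1 L.
Proof.
rewrite /chain_path /mkseq /= subn0 -(addn0 1) iotaDl -map_comp.
by congr (_ :: _); apply: eq_map => j; rewrite /= -subn1 subnDA.
Qed.

Lemma last_chain_path s q L :
  last s (chain_path q L.+1) = chain_state (q - L).
Proof. by rewrite (last_nth s) size_chain_path /= nth_chain_path. Qed.

Lemma take_chain_path k q L :
  k <= L -> take k (chain_path q L) = chain_path q k.
Proof.
by move=> kL; rewrite /chain_path /mkseq -map_take take_iota (minn_idPl kL).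
Qed.

Lemma drop_chain_path k q L :
  drop k (chain_path q L) = chain_path (q - k) (L - k).
Proof.
rewrite /chain_path /mkseq -map_drop drop_iota add0n -[k in iota k]addn0 iotaDl.
by rewrite -map_comp; apply: eq_map => j /=; congr chain_state; lia.
Qed.

Lemma eq_chain_path q q' L :
  same_upto M L q q' -> chain_path q L = chain_path q' L.
Proof.
move=> sq; apply: (@eq_from_nth _ ord0); rewrite !size_chain_path // => j jL.
by rewrite !nth_chain_path //; congr inord; case: sq; lia.
Qed.

Lemma follows_chain_path q L :
  follows (fun x y => chain_next x y) (chain_state q) (chain_path q.-1 L).
Proof.
elim: L q => [|L IH] q //; rewrite chain_pathS /=; split; last exact: IH.
exact: chain_next_state.
Qed.

Lemma is_trace_chain_path i q L :
  0 < L -> @is_trace AP (chain i) (chain_path q L).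
Proof.
by case: L => // L _; rewrite chain_pathS; apply: follows_chain_path.
Qed.

Hypothesis M_gt0 : 0 < M.

Lemma mem_chain_mu p q : (p \in chain_mu (chain_state q)) = (q == 0).
Proof.
rewrite /chain_mu val_chain_state.
by case: eqP => h; rewrite !inE; case: eqP; lia.
Qed.

Lemma chain_path_inj q q' L :
  0 < L -> chain_path q L = chain_path q' L -> same_upto M L q q'.
Proof.
move=> L0 eqp.
have eqj j : j < L -> minn M (q - j) = minn M (q' - j).
  move=> jL; apply: chain_state_inj.
  by rewrite -(nth_chain_path ord0 q jL) eqp nth_chain_path.
(* The last position decides, unless both differences are truncated to [0] there; then the times [q]
   and [q'] lie within the trace and settle it. *)
have h1 := eqj L.-1; have h2 := eqj q; have h3 := eqj q'.
by rewrite /same_upto; lia.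
Qed.

(** Going back one step adds one to the time at which [0] is reached, even inside the loop at [M];
    only a head already at [0] keeps that time at [0]. *)
Lemma chain_traceP i (rho : seq 'I_M.+1) :
  @is_trace AP (chain i) rho -> exists q, rho = chain_path q (size rho).
Proof.
case: rho => // x l /=; elim: l x => [|y l IH] x /=.
  exists x; rewrite chain_pathS /chain_path /=; congr (_ :: _).
  by apply: val_inj; rewrite /= val_chain_state; have := ltn_ord x; lia.
case=> nxy /IH [q]; rewrite chain_pathS => -[yq lq].
have yE : y = minn M q :> nat by rewrite yq val_chain_state.
have xM := ltn_ord x; have yM := ltn_ord y; rewrite /chain_next in nxy.
have [q' [q'y q'x]] : exists q', y :: l = chain_path q'.-1 (size l).+1 /\
    x = minn M q' :> nat.
  case: (posnP x) => x0; first last.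
    by exists q.+1; split; [rewrite chain_pathS -yq -lq|lia].
  exists q; split; last by lia.
  by have -> : q.-1 = q; [lia|rewrite chain_pathS -yq -lq].
exists q'; rewrite [RHS]chain_pathS -q'y; congr (_ :: _).
by apply: val_inj; rewrite /= val_chain_state.
Qed.

(** [0] is absorbing and the only labelled state, so a trace satisfies [p] throughout exactly when
    it starts there. *)
Definition st_lab (p : AP) (c : nat * nat) : Prop := c.1 = 0.

Definition st_rep (rho : seq 'I_M.+1) (c : nat * nat) : Prop :=
  0 < c.2 /\ rho = chain_path c.1 c.2.

Lemma st_rep_lab i p rho c :
  st_rep rho c -> @trace_lab AP (chain i) p rho <-> st_lab p c.
Proof.
case: c => q L [/= L0 ->]; rewrite /trace_lab /st_lab /=.
split=> [/(all_nthP (inord i))/(_ 0)|->].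
  rewrite size_chain_path nth_chain_path // mem_chain_mu subn0.
  by move=> /(_ L0)/eqP.
apply/(all_nthP (inord i)) => j; rewrite size_chain_path => jL.
by rewrite nth_chain_path // mem_chain_mu.
Qed.

Lemma st_rep_forth i d (rho rho' : seq 'I_M.+1) c :
  st_rep rho c -> @trace_step AP (chain i) d rho rho' ->
  exists c', st_step M d c c' /\ st_rep rho' c'.
Proof.
case: c => q L [/= L0 ->]; rewrite /st_rep.
case: d => /=.
- case=> k; rewrite size_chain_path => -[kL ->].
  exists (q, k); rewrite take_chain_path; last by lia.
  by split; [lia|split=> //=; lia].
- case=> k; rewrite size_chain_path => -[kL ->].
  exists (q - k, L - k); rewrite drop_chain_path.
  by split; [exists k; lia|split=> //=; lia].
- case=> ext [ext0 [tr def]]; have [q' eqt] := chain_traceP tr.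
  have sz := congr1 size def; rewrite size_cat size_chain_path in sz.
  have ext1 : 0 < size ext by case: ext ext0 {def sz}.
  exists (q', size rho'); split; last by split=> //=; lia.
  split; first by lia.
  apply: chain_path_inj => //.
  rewrite -(take_chain_path q' (L := size rho')); last by lia.
  by rewrite -eqt def take_size_cat // size_chain_path.
- case=> ext [ext0 [tr def]]; have [q' eqt] := chain_traceP tr.
  have sz := congr1 size def; rewrite size_cat size_chain_path in sz.
  have ext1 : 0 < size ext by case: ext ext0 {def sz}.
  have sq : same_upto M L (q' - size ext) q.
    apply: chain_path_inj => //.
    have <- : drop (size ext) rho' = chain_path q L.
      by rewrite def drop_size_cat.
    by rewrite eqt drop_chain_path; congr chain_path; lia.
  (* If the two times differ, the old trace lies in the loop at [M]. The prepended states then lie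
     there as well, and [q + size ext] describes the same extension. *)
  case: (eqVneq (q' - size ext) q) => [eqq|neq].
    exists (q', L + size ext); split; first by exists (size ext); split; [lia|].
    by split=> /=; [lia|rewrite eqt sz addnC].
  exists (q + size ext, L + size ext); split; first by exists (size ext); lia.
  split=> /=; first by lia.
  rewrite eqt sz addnC; apply: eq_chain_path.
  by case: sq neq; rewrite /same_upto; lia.
Qed.

Lemma st_rep_back i d rho c c' :
  st_rep rho c -> st_step M d c c' ->
  exists rho', @trace_step AP (chain i) d rho rho' /\ st_rep rho' c'.
Proof.
case: c c' => q L [q' L'] [/= L0 ->] step.
suff [L'0 ts] : 0 < L' /\
    @trace_step AP (chain i) d (chain_path q L) (chain_path q' L').
  by exists (chain_path q' L').
case: d step => /=.
- case=> -> L'L; split; first by lia.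
  by exists L'; rewrite size_chain_path take_chain_path; [split=> //|]; lia.
- case=> k [kL [-> ->]]; split; first by lia.
  by exists k; rewrite size_chain_path drop_chain_path; split=> //; lia.
- case=> LL' sq; split; first by lia.
  exists (drop L (chain_path q' L')); split.
    by move/(congr1 size); rewrite size_drop size_chain_path /=; lia.
  split; first by apply: is_trace_chain_path; lia.
  rewrite (eq_chain_path sq) -(take_chain_path q' (k := L) (L := L')).
    by rewrite cat_take_drop.
  by lia.
- case=> k [k0 [-> <-]]; split; first by lia.
  exists (take k (chain_path q' (L + k))); split.
    by move/(congr1 size); rewrite size_take_min size_chain_path /=; lia.
  split; first by apply: is_trace_chain_path; lia.
  rewrite -{1}(cat_take_drop k (chain_path q' (L + k))) drop_chain_path.
  by rewrite addnK.
Qed.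

Lemma sat_st_chain i f rho c :
  st_rep rho c ->
  @sat_st AP (chain i) f rho <-> sat_frame st_lab (st_step M) f c.
Proof.
move=> rc; rewrite sat_stE.
(* A relation that does not depend on the rounds turns the game into a bisimulation. *)
apply: (@sat_frame_game _ _ _ _ _ _ _ (fun _ => st_rep)) (leqnn _) rc.
- by move=> _ ? ? ?; apply: st_rep_lab.
- by move=> _ ? ? ? ?; apply: st_rep_forth.
- by move=> _ ? ? ? ?; apply: st_rep_back.
Qed.

(** * Traces of the computation tree of the chain *)

Section ComputationTree.
Variable i : nat.
Hypothesis le_iM : i <= M.

Let ctree := comp_tree (chain i).

Lemma chain_stateE q : minn M q = i <-> chain_state q = inord i.
Proof.
split=> [qi|/(congr1 val)]; first by rewrite /chain_state qi.
by rewrite /= val_chain_state inordK.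
Qed.

Lemma chain_path_init q j :
  minn M q = i -> @is_init_trace AP (chain i) (chain_path q j.+1).
Proof.
move=> /chain_stateE qi; rewrite chain_pathS; split=> //.
exact: follows_chain_path.
Qed.

Definition ct_node q (qi : minn M q = i) (j : nat) : ct_state (chain i) :=
  exist _ (chain_path q j.+1) (chain_path_init j qi).

(** A trace of the tree is a run of consecutive prefixes of one initial trace; the node at time [j]
    has length [j.+1]. The condition on [minn M q] fixes the initial state. *)
Definition ct_rep (rho : seq (ct_state (chain i))) (c : nat * nat * nat) :
    Prop :=
  let: (x, q, L) := c in
  [/\ x < L, minn M q = i &
      map sval rho = [seq chain_path q j.+1 | j <- iota x (L - x)]].

Lemma is_trace_ct_path q x n rho :
  map sval rho = [seq chain_path q j.+1 | j <- iota x n.+1] ->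
  @is_trace AP ctree rho.
Proof.
case: rho => // c rho [+ ] /=.
elim: n x c rho => [|n IH] x c [|c' rho] //= cx [c'x defr].
split; last exact: (IH x.+1).
exists (chain_state (q - x.+1)); rewrite cx c'x.
exact: mkseqS.
Qed.

(** A node is its successor without the last state, so the path found for the tail of the trace also
    covers its head. *)
Lemma ct_traceP rho :
  @is_trace AP ctree rho -> exists c, ct_rep rho c.
Proof.
have last_rep (c : ct_state (chain i)) : exists2 q, minn M q = i &
    exists n, sval c = chain_path q n.+1.
  case: c => w /= init_w.
  have tr_w : @is_trace AP (chain i) w by case: w init_w => //= ? ? [].
  have [q] := chain_traceP tr_w.
  case: w init_w tr_w => // s w [s0 _] _ /= eqw; exists q.
    apply/chain_stateE; move: eqw; rewrite chain_pathS => -[<- _].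
    exact: s0.
  by exists (size w).
suff H (c : ct_state (chain i)) l : follows (@ct_delta AP (chain i)) c l ->
    exists c', ct_rep (c :: l) c' by case: rho => // c l /H.
elim: l c => [|c1 l IH] c /=.
  move=> _; have [q qi [n cE]] := last_rep c.
  by exists (n, q, n.+1); split=> //=; rewrite subSnn /= cE.
case=> -[s c1E] /IH [[[x q] L] [xL qi]] /=.
rewrite -[L - x]prednK ?subn_gt0 //= => -[c1x lE].
have cE : sval c = chain_path q x.
  rewrite -(take_chain_path q (leqnSn x)) -c1x c1E -cats1 take_size_cat //.
  by move/(congr1 size): c1x; rewrite c1E size_rcons size_chain_path => -[].
(* [x = 0] would make the node [c] the empty sequence. *)
case: x xL c1x lE cE => [|x] xL c1x lE cE.
  by case: c cE {c1E} => -[|? ?].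
exists (x, q, L); split=> //; first by lia.
have -> : L - x = (L - x.+1).-1.+2 by lia.
by rewrite /= cE c1x lE.
Qed.

(** The length of the first node determines [x], and the last node contains the whole past, so
    [chain_path_inj] applies to it. *)
Lemma ct_path_inj q q' x x' n : 0 < n ->
  [seq chain_path q j.+1 | j <- iota x n] =
  [seq chain_path q' j.+1 | j <- iota x' n] ->
  x = x' /\ same_upto M (x + n) q q'.
Proof.
move=> n0 eqs.
have eqj j : j < n -> chain_path q (x + j).+1 = chain_path q' (x' + j).+1.
  move=> jn; move/(congr1 (fun s => nth [::] s j)): eqs.
  by rewrite !(nth_map 0) ?size_iota // !nth_iota.
have xx : x = x'.
  by move/(congr1 size): (eqj 0 n0); rewrite !size_chain_path !addn0 => -[].
split=> //; apply: chain_path_inj; first by lia.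
move: (eqj n.-1); rewrite -xx -addnS prednK //; apply; lia.
Qed.

Lemma eq_ct_path q q' L x n : x + n <= L -> same_upto M L q q' ->
  [seq chain_path q j.+1 | j <- iota x n] =
  [seq chain_path q' j.+1 | j <- iota x n].
Proof.
move=> xnL sq; apply/eq_in_map => j; rewrite mem_iota => jx.
apply: eq_chain_path; move: sq; rewrite /same_upto; lia.
Qed.

(** A node carries the label of its last state, so [p] holds on the whole interval exactly when [0]
    has been reached by time [x]. *)
Definition ct_lab (p : AP) (c : nat * nat * nat) : Prop := c.1.2 <= c.1.1.

Lemma ct_rep_lab p rho c :
  ct_rep rho c -> @trace_lab AP ctree p rho <-> ct_lab p c.
Proof.
case: c => [[x q] L] [xL qi rhoE]; rewrite /trace_lab /ct_lab /=.
have -> : all (fun s => p \in @kmu AP ctree s) rho =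
    all (fun w => p \in chain_mu (last (inord i) w)) (map sval rho).
  by rewrite all_map.
rewrite rhoE all_map (@eq_all _ _ (fun j => q <= j)); last first.
  by move=> j; rewrite -subn_eq0 -(mem_chain_mu p) -(last_chain_path (inord i)).
split=> [/allP/(_ x)|qx]; first by rewrite mem_iota; apply; lia.
by apply/allP => j; rewrite mem_iota; lia.
Qed.

Lemma size_ct_rep rho x q L : ct_rep rho (x, q, L) -> size rho = L - x.
Proof. by case=> _ _ /(congr1 size); rewrite !size_map size_iota. Qed.

Lemma ct_rep_forth d (rho rho' : seq (ct_state (chain i))) c :
  ct_rep rho c -> @trace_step AP ctree d rho rho' ->
  exists c', ct_step M d c c' /\ ct_rep rho' c'.
Proof.
case: c => [[x q] L] rc; have sz := size_ct_rep rc; case: rc => xL qi rhoE.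
case: d => /=.
- case=> k; rewrite sz => -[kL ->]; exists (x, q, x + k).
  split; first by do ![split=> //]; lia.
  split=> //; first by lia.
  rewrite map_take rhoE -map_take take_iota; congr map; congr iota; lia.
- case=> k; rewrite sz => -[kL ->]; exists (x + k, q, L).
  split; first by do ![split=> //]; lia.
  split=> //; first by lia.
  rewrite map_drop rhoE -map_drop drop_iota; congr map; congr iota; lia.
- case=> ext [ext0 [tr def]].
  have [[[x1 q1] L1] rc1] := ct_traceP tr.
  have := size_ct_rep rc1; rewrite def size_cat sz => sz1.
  have ext1 : 0 < size ext by case: ext ext0 {def sz1}.
  exists (x1, q1, L1); split; last by rewrite -def.
  case: rc1 => x1L1 q1i /(congr1 (take (L - x))).
  rewrite def -map_take take_size_cat // rhoE -map_take take_iota.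
  have -> : minn (L - x) (L1 - x1) = L - x by lia.
  case/ct_path_inj; first by lia.
  move=> xx sq; rewrite subnKC // in sq; last exact: ltnW.
  by do ![split=> //]; lia.
- case=> ext [ext0 [tr def]].
  have [[[x1 q1] L1] rc1] := ct_traceP tr.
  have := size_ct_rep rc1; rewrite def size_cat sz => sz1.
  have ext1 : 0 < size ext by case: ext ext0 {def sz1}.
  case: rc1 => x1L1 q1i rho'E.
  move: (congr1 (drop (size ext)) rho'E).
  rewrite def -map_drop drop_size_cat // rhoE -map_drop drop_iota.
  have -> : L1 - x1 - size ext = L - x by lia.
  case/ct_path_inj; first by lia.
  move=> xx sq; rewrite subnKC // in sq; last exact: ltnW.
  (* The last node is unchanged by a left extension, so [q] can replace the time [q1] found for the
     extended trace. *)
  exists (x1, q, L); split; first by do ![split=> //]; lia.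
  split=> //; first by lia.
  rewrite -def rho'E; have -> : L1 = L by lia.
  by rewrite (eq_ct_path _ sq) //; lia.
Qed.

Lemma ct_rep_back d rho c c' :
  ct_rep rho c -> ct_step M d c c' ->
  exists rho', @trace_step AP ctree d rho rho' /\ ct_rep rho' c'.
Proof.
case: c c' => [[x q] L] [[x' q'] L'] rc; have sz := size_ct_rep rc.
case: rc => xL qi rhoE.
case: d => /=.
- case=> -> [-> L'x]; exists (take (L' - x) rho); split.
    by exists (L' - x); rewrite sz; split=> //; lia.
  split=> //; first by lia.
  rewrite map_take rhoE -map_take take_iota; congr map; congr iota; lia.
- case=> -> [-> xx']; exists (drop (x' - x) rho); split.
    by exists (x' - x); rewrite sz; split=> //; lia.
  split=> //; first by lia.
  rewrite map_drop rhoE -map_drop drop_iota; congr map; congr iota; lia.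
- case=> -> [LL' sq].
  have q'i : minn M q' = i by move: sq; rewrite /same_upto; lia.
  pose ext := [seq ct_node q'i j | j <- iota L (L' - L)].
  have rho'E : map sval (rho ++ ext) =
      [seq chain_path q' j.+1 | j <- iota x (L' - x)].
    have -> : L' - x = L - x + (L' - L) by lia.
    rewrite iotaD !map_cat rhoE (eq_ct_path _ sq); last by lia.
    by rewrite subnKC ?(ltnW xL) // -map_comp.
  exists (rho ++ ext); split; last by split=> //; lia.
  exists ext; split.
    by move/(congr1 size); rewrite size_map size_iota /=; lia.
  split=> //; apply: (@is_trace_ct_path q' x (L' - x).-1).
  by rewrite prednK //; lia.
- case=> -> [-> x'x].
  pose ext := [seq ct_node qi j | j <- iota x' (x - x')].
  have rho'E : map sval (ext ++ rho) =
      [seq chain_path q j.+1 | j <- iota x' (L - x')].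
    have -> : L - x' = x - x' + (L - x) by lia.
    rewrite iotaD !map_cat rhoE subnKC; last by lia.
    by rewrite -map_comp.
  exists (ext ++ rho); split; last by split=> //; lia.
  exists ext; split.
    by move/(congr1 size); rewrite size_map size_iota /=; lia.
  split=> //; apply: (@is_trace_ct_path q x' (L - x').-1).
  by rewrite prednK //; lia.
Qed.

Lemma sat_ct_chain f rho c :
  ct_rep rho c ->
  @sat_st AP ctree f rho <-> sat_frame ct_lab (ct_step M) f c.
Proof.
move=> rc; rewrite sat_stE.
apply: (@sat_frame_game _ _ _ _ _ _ _ (fun _ => ct_rep)) (leqnn _) rc.
- by move=> _ ? ? ?; apply: ct_rep_lab.
- by move=> _ ? ? ? ?; apply: ct_rep_forth.
- by move=> _ ? ? ? ?; apply: ct_rep_back.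
Qed.

End ComputationTree.
End Chain.

(* The linear reading; state-based, it says that [p] is always reachable. *)
Definition infinitely_often (AP : Type) (p : AP) : hs AP :=
  HBbar (HE (HProp p)).

(** * From the games to formulas *)

Lemma sim_sat (AP C : Type) (lab : AP -> C -> Prop)
    (step : move -> C -> C -> Prop) (sim : nat -> C -> C -> Prop) M :
  (forall T c c' p, 0 < T -> sim T c c' -> lab p c <-> lab p c') ->
  (forall T c c', sim T c c' -> sim T c' c) ->
  (forall T d c1 c1' c2, 0 < T -> T + T < M -> sim (T + T) c1 c2 ->
     step d c1 c1' -> exists c2', step d c2 c2' /\ sim T c1' c2') ->
  forall f n c c', hs_depth f <= n -> 2 ^ n < M -> sim (2 ^ n) c c' ->
    sat_frame lab step f c <-> sat_frame lab step f c'.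
Proof.
move=> sim_lab sim_sym sim_step f n c c' fn nM sc.
(* Each round halves the threshold, so [2 ^ k] lasts for [k] rounds and is still positive at the
   end, where labels are compared. *)
pose R k c c' := 2 ^ k < M /\ sim (2 ^ k) c c'.
have R_step k d c1 c1' c2 : R k.+1 c1 c2 -> step d c1 c1' ->
    exists c2', step d c2 c2' /\ R k c1' c2'.
  rewrite /R expnS mul2n -addnn => -[kM s12] st.
  have [||c2' [st' s']] := sim_step _ _ _ _ _ _ _ s12 st.
  - by rewrite expn_gt0.
  - exact: kM.
  - by exists c2'; do !split=> //; lia.
have Rc : R n c c' by [].
apply: (@sat_frame_game _ _ _ _ _ _ _ R) fn Rc => [k c1 c2 p [_]| |].
- by apply: sim_lab; rewrite expn_gt0.
- exact: R_step.
- move=> k d c1 c2 c2' [kM /sim_sym s12] st.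
  have [c1' [st' [kM' /sim_sym s']]] := R_step _ _ _ _ _ (conj kM s12) st.
  by exists c1'.
Qed.

Lemma st_sim_sat (AP : finType) M (f : hs AP) n c c' :
  hs_depth f <= n -> 2 ^ n < M -> st_sim (2 ^ n) c c' ->
  sat_frame (@st_lab AP) (st_step M) f c <->
  sat_frame (@st_lab AP) (st_step M) f c'.
Proof.
move=> fn nM sc; apply: (sim_sat (sim := st_sim)) fn nM sc => [T c1 c2 p T0||].
- by rewrite /st_lab; case=> /= *; unfold eq_upto in *; lia.
- exact: st_sim_sym.
- by move=> T d c1 c1' c2 /ltP T0 /ltP TM; apply: st_sim_step.
Qed.

Lemma ct_sim_sat (AP : finType) M (f : hs AP) n c c' :
  hs_depth f <= n -> 2 ^ n < M -> ct_sim (2 ^ n) c c' ->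
  sat_frame (@ct_lab AP) (ct_step M) f c <->
  sat_frame (@ct_lab AP) (ct_step M) f c'.
Proof.
move=> fn nM sc; apply: (sim_sat (sim := ct_sim)) fn nM sc => [T c1 c2 p T0||].
- by rewrite /ct_lab; case=> /= *; unfold eq_upto in *; lia.
- exact: ct_sim_sym.
- by move=> T d c1 c1' c2 /ltP T0 /ltP TM; apply: ct_sim_step.
Qed.

Lemma models_st_chain (AP : finType) (f : hs AP) n :
  hs_depth (always f) <= n ->
  models_st (chain AP (2 ^ n).+2 (2 ^ n).+1) f <->
  models_st (chain AP (2 ^ n).+2 (2 ^ n).+2) f.
Proof.
move=> fn; have M0 : 0 < (2 ^ n).+2 by [].
have rep i : i <= (2 ^ n).+2 -> @st_rep (2 ^ n).+2 [:: inord i] (i, 1).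
  by move=> iM; split=> //=; rewrite chain_pathS /chain_state (minn_idPr iM).
rewrite !models_stE !(sat_st_chain M0 _ _ (rep _ _)) //.
apply: st_sim_sat fn _ _ => //.
(* From [M - 1] and from [M], the gaps behind the one-state trace are [2 ^ n] and [2 ^ n + 1]:
   different, but both at the threshold. *)
by apply: (@StWhite _ _ _ _ _ (2 ^ n) (2 ^ n).+1); rewrite /eq_upto; lia.
Qed.

Lemma models_ct_chain (AP : finType) (f : hs AP) n :
  hs_depth (always f) <= n ->
  models_st (comp_tree (chain AP (2 ^ n).+2 (2 ^ n).+1)) f <->
  models_st (comp_tree (chain AP (2 ^ n).+2 (2 ^ n).+2)) f.
Proof.
move=> fn; have M0 : 0 < (2 ^ n).+2 by [].
have rep i : i <= (2 ^ n).+2 ->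
    ct_rep [:: ct_s0 (chain AP (2 ^ n).+2 i)] (0, i, 1).
  move=> iM; split=> //=; first exact/minn_idPr.
  by rewrite chain_pathS /chain_state (minn_idPr iM).
rewrite !models_stE !(sat_ct_chain M0 _ _ (rep _ _)) //.
apply: ct_sim_sat fn _ _ => //.
by apply: (@CtWhite _ _ _ _ _ _ _ 1 (2 ^ n) 1 (2 ^ n).+1);
  rewrite /eq_upto; lia.
Qed.

(** * Recurrence of [p] along the paths of a chain *)

Lemma chain_infinitely_often (AP : finType) (p : AP) M i :
  i < M -> models_lin (chain AP M i) (infinitely_often p).
Proof.
move=> iM pi [pi0 pi_next] y /=.
have piE j : pi j = i - j :> nat.
  elim: j => [|j IH]; first by rewrite pi0 subn0 inordK // ltnW.
  have := pi_next j; rewrite /= /chain_next IH; lia.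
(* This time is later than [y] and late enough to be in state [0]; it also serves as the left end,
   giving a one-point suffix. *)
exists (y + i).+1; split; first by lia.
exists (y + i).+1; split; first by lia.
move=> h /= hy; rewrite /chain_mu piE.
by have -> : i - h = 0; [lia|rewrite inE].
Qed.

Lemma chain_not_infinitely_often (AP : finType) (p : AP) M :
  0 < M -> ~ models_lin (chain AP M M) (infinitely_often p).
Proof.
move=> M0 all_io; have stay : inf_init_path (K := chain AP M M) (fun=> inord M).
  by split=> // _; rewrite /= /chain_next inordK // eqxx orbT.
have [z [_ [v [/andP[_ vz] /(_ z)]]]] := all_io _ stay 0.
rewrite vz leqnn /= /chain_mu inordK // => /(_ isT).
by case: eqP => [|_]; [lia|rewrite inE].
Qed.

(** * Linear semantics and the removal of branches *)

Lemma eq_sat_lin (AP : finType) (K K' : kripke AP) pi pi' f x y :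
  (forall j, @kmu AP K (pi j) = @kmu AP K' (pi' j)) ->
  sat_lin pi f x y <-> sat_lin pi' f x y.
Proof.
move=> eqmu.
elim: f x y => [p|g IH|g IHg h IHh|g IH|g IH|g IH|g IH] x y /=.
- by split=> + h xhy => /(_ h xhy); rewrite eqmu.
- by rewrite IH.
- by rewrite IHg IHh.
- by split=> -[z [xz /IH gz]]; exists z.
- by split=> -[z [xz /IH gz]]; exists z.
- by split=> -[z [xz /IH gz]]; exists z.
- by split=> -[z [xz /IH gz]]; exists z.
Qed.

Lemma bool_total : forall s : bool, exists t : bool, (fun _ _ => true) s t.
Proof. by move=> s; exists s. Qed.

Lemma unit_total : forall s : unit, exists t : unit, (fun _ _ => true) s t.
Proof. by move=> s; exists s. Qed.

Definition two_state (AP : finType) : fin_kripke AP :=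
  @FinKripke AP bool (fun _ _ => true) (fun b => if b then setT else set0)
    false bool_total.

Definition one_state (AP : finType) : fin_kripke AP :=
  @FinKripke AP unit (fun _ _ => true) (fun=> set0) tt unit_total.

(** The path of [two_state] that never leaves [false] has the same labels as the only path of
    [one_state]. *)
Lemma models_lin_one_state (AP : finType) f :
  models_lin (two_state AP) f -> models_lin (one_state AP) f.
Proof.
move=> mf pi _ j; apply/(@eq_sat_lin _ _ (two_state AP) _ (fun=> false)) => //.
exact: mf.
Qed.

(** Appending a successor labelled [p] yields an extension with a one-state suffix satisfying [p].
    Finiteness is not assumed, so that computation trees are covered. *)
Lemma models_st_reach (AP : finType) (K : kripke AP) (p : AP) :
  (forall s : kst K, exists t, kdelta s t /\ p \in kmu t) ->
  models_st K (infinitely_often p).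
Proof.
move=> reach [|x l] //= [_ xl]; have [t [dt pt]] := reach (last x l).
exists [:: t]; split=> //; split.
  by rewrite cats1; apply: follows_rcons.
exists (size l).+1; split; first by rewrite size_cat /=; lia.
by rewrite -/(size (x :: l)) -cat_cons drop_size_cat //= pt.
Qed.

Lemma not_models_st_reach (AP : finType) (K : kripke AP) (p : AP) :
  (forall s : kst K, kmu s = set0) -> ~ models_st K (infinitely_often p).
Proof.
move=> mu0 /(_ [:: ks0 K]) [] // ext [_ [_ [k [ks]]]] /=.
case E: (drop k _) => [|t l] /=; last by rewrite mu0 inE.
by move/(congr1 size): E; rewrite size_drop /=; move: ks => /=; lia.
Qed.

Theorem theorem5p12 (AP : finType) (hAP : 0 < #|AP|) :
  expr_incomparable (@HS_lin AP) (@HS_st AP) /\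
  expr_incomparable (@HS_lin AP) (@HS_ct AP).
Proof.
have /card_gt0P[p _] := hAP.
have reach2 (s : kst (two_state AP)) :
  exists t : kst (two_state AP), kdelta s t /\ p \in kmu t.
  by exists true; rewrite /= inE.
split; split.
(* A linear equivalent [f] would carry the formula from [two_state], where [p] is always reachable,
   to [one_state], where [p] never holds. *)
- move=> /(_ (infinitely_often p))[f eqf].
  apply: (@not_models_st_reach _ (one_state AP) p) => //.
  by apply/eqf/models_lin_one_state/eqf/models_st_reach.
(* A state-based equivalent [f] has a fixed depth; the chain chosen for [always f] hides from it the
   difference between the two initial states. *)
- move=> /(_ (infinitely_often p))[f eqf].
  have fn := leqnn (hs_depth (always f)).
  apply: (@chain_not_infinitely_often _ p (2 ^ hs_depth (always f)).+2) => //.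
  apply/eqf/(models_st_chain fn)/eqf.
  exact: chain_infinitely_often.
- move=> /(_ (infinitely_often p))[f eqf].
  apply: (@not_models_st_reach _ (comp_tree (one_state AP)) p) => //.
  apply/eqf/models_lin_one_state/eqf/models_st_reach => -[[|x l] //= [x0 xl]].
  have init_t : @is_init_trace AP (two_state AP) (x :: rcons l true).
    by split=> //; apply: follows_rcons.
  (* In the tree, the successor labelled [p] is the node prolonged by [true]. *)
  exists (exist _ _ init_t); split; first by exists true.
  by rewrite /ct_mu /= last_rcons inE.
- move=> /(_ (infinitely_often p))[f eqf].
  have fn := leqnn (hs_depth (always f)).
  apply: (@chain_not_infinitely_often _ p (2 ^ hs_depth (always f)).+2) => //.
  apply/eqf/(models_ct_chain fn)/eqf.
  exact: chain_infinitely_often.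
Qed.
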